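(* For $n=2$, primality is verified directly. For $n>2$, suppose given a Lucas--Pratt certificate for $n$: a residue $g$ modulo $n$, a verified equality $n-1=\prod_{i=1}^{r}q_i^{e_i}$ with the $q_i$ distinct and $e_i\ge1$, and recursive primality certificates (of the same kind) for the $q_i$, such that $g^{n-1}\equiv1\pmod n$ and, for every $q_i$, $g^{(n-1)/q_i}\not\equiv1\pmod n$. Then these data construct a multiplicative inverse for every nonzero residue modulo $n$, and hence certify that $n$ is prime.
   Context: $n$ is prime means $n>1$ and there are no $a,b\le n$ with $a>1$, $b>1$ and $ab=n$. Certificates are finite inductively generated objects: the prime $2$ is certified directly, and for $n>2$ a certificate consists of the data listed in the claim, whose subcertificates concern the numbers $q_i$. Logic is intuitionistic. *)

(* Defs.v *)
From mathcomp Require Import all_boot all_order all_algebra.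

Set Implicit Arguments.
Unset Strict Implicit.
Unset Printing Implicit Defensive.

Import GRing.Theory.
Local Open Scope ring_scope.

(* Unlike the boolean [prime], this is the bounded-search definition; the two
   are shown to agree in [is_primeP]. *)
Definition is_prime (n : nat) : Prop :=
  (1 < n)%N /\
  ~ (exists a b : nat, [/\ (a <= n)%N, (b <= n)%N, (1 < a)%N, (1 < b)%N
                         & (a * b)%N = n]).

Lemma is_primeP (n : nat) : reflect (is_prime n) (prime n).
Proof.
apply: (iffP primeP) => [[n1 dn] | [n1 nab]]; split=> //.
- case=> a [b [_ _ a1 b1 abn]].
  have /orP[/eqP aE|/eqP aE] : (a == 1%N) || (a == n).
  + by apply: dn; apply/dvdnP; exists b; rewrite mulnC.
  + by rewrite aE in a1.
  + have n0 : (0 < n)%N by apply: ltnW.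
    by have := ltn_Pmulr b1 n0; rewrite -[X in (_ < X * _)%N]aE abn ltnn.
- move=> d /dvdnP[k nE]; rewrite /= -implyNb; apply/implyP => d1.
  apply/negP => /negP dn; apply: nab; exists k, d.
  have n0 : (0 < n)%N by apply: ltnW.
  move: (n0); rewrite {1}nE muln_gt0 => /andP[k0 d0].
  split=> //.
  + by rewrite nE leq_pmulr.
  + by rewrite nE leq_pmull.
  + rewrite ltn_neqAle k0 andbT eq_sym; apply: contra dn => /eqP kE.
    by rewrite nE kE mul1n.
  + by rewrite ltn_neqAle d0 andbT eq_sym.
Qed.

(* The certificates live in [Type] because they are data from which inverses
   are computed. ['Z_n] is the ring of residues modulo [n] only for [1 < n],
   which [2 < n] ensures below. *)
Inductive pratt_cert : nat -> Type :=
| PrattTwo : pratt_cert 2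
| PrattStep (n : nat) (g : 'Z_n) (r : nat) (q e : 'I_r -> nat) of
    (2 < n)%N
  & injective q
  & (forall i, (1 <= e i)%N)
  & (n - 1 = \prod_(i < r) q i ^ e i)%N
  & (forall i, pratt_cert (q i))
  & g ^+ (n - 1) = 1
  & (forall i, g ^+ ((n - 1) %/ q i) <> 1) : pratt_cert n.

(* Main.v *)
Require Import Defs.
From mathcomp Require Import all_boot all_order all_algebra.

(** Since the [q i] are prime, each prime divisor of [n - 1] is one of them.
    The order of [g] divides [n - 1]; a proper divisor of [n - 1] already
    divides [(n - 1) / q i] for some [i], which the last condition of the
    certificate excludes.  So [g] has order exactly [n - 1]
    ([primitive_root_prime_divisors]).  Its [n - 1] distinct powers are
    nonzero, hence exhaust the [n - 1] nonzero residues, and a nonzero residue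
    [g ^+ k] has inverse [g ^+ (n - 1 - k)]
    ([primitive_root_inverse]).  Finally, a factorization [a * b = n] with
    [1 < a, b] would make the nonzero residue of [a] both invertible and a zero
    divisor ([is_prime_of_Zn_inverses]).  That the [q i] are prime comes from
    their own certificates, by induction ([pratt_cert_prime]).

    The exponent [k] is found by searching the finite set of exponents, so the
    inverses are computed from the certificate and the argument stays
    intuitionistic. *)

Set Implicit Arguments.
Unset Strict Implicit.
Unset Printing Implicit Defensive.

Import GRing.Theory.
Local Open Scope ring_scope.

(** If the order [m] of [z] were a proper divisor of [N], a prime divisor [p]
    of [N / m] would give [m %| N / p]. *)
Lemma primitive_root_prime_divisors (R : nzRingType) (N : nat) (z : R) :
    (0 < N)%N -> z ^+ N = 1 ->
    (forall p, prime p -> (p %| N)%N -> z ^+ (N %/ p) != 1) ->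
  N.-primitive_root z.
Proof.
move=> N_gt0 zN1 zNp; have [m zm mN] := prim_order_exists N_gt0 zN1.
have [k NE] := dvdnP mN; case: (ltngtP k 1) => [|k_gt1|k1].
- by rewrite ltnS leqn0 => /eqP k0; move: N_gt0; rewrite NE k0.
- have p_pr := pdiv_prime k_gt1; have [l kE] := dvdnP (pdiv_dvd k).
  have NpE : N = (l * m * pdiv k)%N by rewrite NE {1}kE mulnAC.
  have pN : (pdiv k %| N)%N by rewrite NpE dvdn_mull.
  have := zNp _ p_pr pN; rewrite {1}NpE mulnK ?prime_gt0 //.
  by rewrite -(prim_order_dvd zm) dvdn_mull.
- by rewrite NE k1 mul1n.
Qed.

(** The powers of [z] are distinct and nonzero, since [z] is invertible; there
    are as many of them as there are nonzero elements. *)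
Lemma primitive_root_powers_surj (R : finNzRingType) (z : R) (x : R) :
    #|R|.-1.-primitive_root z -> x != 0 ->
  x \in codom (fun i : 'I_#|R|.-1 => z ^+ i).
Proof.
move=> zR x_neq0.
have z_inj : injective (fun i : 'I_#|R|.-1 => z ^+ i).
  move=> i j /eqP; rewrite (eq_prim_root_expr zR) !modn_small //.
  by move/eqP/val_inj.
have sub : codom (fun i : 'I_#|R|.-1 => z ^+ i) \subset predC1 (0 : R).
  apply/subsetP => _ /codomP[i ->]; rewrite inE; apply/eqP => zi0.
  have := prim_expr_order zR; rewrite -(subnKC (ltnW (ltn_ord i))) exprD zi0.
  by move/eqP; rewrite mul0r eq_sym oner_eq0.
have eqc : #|codom (fun i : 'I_#|R|.-1 => z ^+ i)| = #|predC1 (0 : R)|.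
  by rewrite card_codom // card_ord cardC1.
by rewrite (subset_cardP eqc sub) inE.
Qed.

(** The exponent [k] with [z ^+ k = x] is the index returned by [iinv], so the
    inverse [z ^+ (#|R| - 1 - k)] is data and not only known to exist. *)
Lemma primitive_root_inverse (R : finNzRingType) (z : R) (x : R) :
  #|R|.-1.-primitive_root z -> x != 0 -> {y : R | x * y = 1}.
Proof.
move=> zR x_neq0; have xz := primitive_root_powers_surj zR x_neq0.
exists (z ^+ (#|R|.-1 - iinv xz)%N); rewrite -[X in X * _](f_iinv xz) /=.
by rewrite -exprD subnKC ?(ltnW (ltn_ord _)) ?(prim_expr_order zR).
Qed.

(** An invertible element is not a zero divisor, whereas both factors of a
    proper factorization [a * b = n] are nonzero residues of product [0]. *)
Lemma is_prime_of_Zn_inverses (n : nat) :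
    (1 < n)%N -> (forall x : 'Z_n, x <> 0 -> {y : 'Z_n | x * y = 1}) ->
  is_prime n.
Proof.
move=> n_gt1 invZ; split=> // -[a [b [_ _ a_gt1 b_gt1 abn]]].
have Zn_neq0 c : (0 < c)%N -> (c < n)%N -> (c%:R : 'Z_n) <> 0.
  move=> c_gt0 c_lt /(congr1 val); rewrite /= val_Zp_nat // modn_small // => c0.
  by rewrite c0 in c_gt0.
have a_gt0 := ltnW a_gt1; have b_gt0 := ltnW b_gt1.
have a_ltn : (a < n)%N by rewrite -abn ltn_Pmulr.
have b_ltn : (b < n)%N by rewrite -abn ltn_Pmull.
have [y ay1] := invZ _ (Zn_neq0 a a_gt0 a_ltn).
apply: (Zn_neq0 b b_gt0 b_ltn).
have -> : (b%:R : 'Z_n) = b%:R * (a%:R * y) by rewrite ay1 mulr1.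
by rewrite mulrA -natrM mulnC abn pchar_Zp // mul0r.
Qed.

(** The part of the argument shared by the induction and the construction of
    inverses: here primality of the [q i] is a hypothesis, so that the
    recursive certificates need not be mentioned. *)
Lemma pratt_step_inverse (n : nat) (g : 'Z_n) (r : nat) (q e : 'I_r -> nat) :
    (1 < n)%N -> (n - 1 = \prod_(i < r) q i ^ e i)%N ->
    (forall i, prime (q i)) -> g ^+ (n - 1) = 1 ->
    (forall i, g ^+ ((n - 1) %/ q i) <> 1) ->
  forall x : 'Z_n, x <> 0 -> {y : 'Z_n | x * y = 1}.
Proof.
move=> n_gt1 nE q_pr g1 gq x /eqP x_neq0.
apply: (primitive_root_inverse (z := g)) => //.
rewrite card_ord Zp_cast // -subn1.
apply: primitive_root_prime_divisors => //; first by rewrite subn_gt0.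
move=> p p_pr; rewrite nE => p_dvd.
have [i p_qi] : exists i, (p %| q i ^ e i)%N.
  apply/existsP; apply: contraLR p_dvd => /existsPn p_ndvd.
  by rewrite (big_morph _ (fun a b => Euclid_dvdM a b p_pr)
                 (Euclid_dvd1 p_pr)) big_has -all_predC; apply/allP => i _ /=.
have /eqP -> : p == q i.
  by move: p_qi; rewrite Euclid_dvdX // dvdn_prime2 // => /andP[].
by rewrite -nE; apply/eqP; apply: gq.
Qed.

Lemma pratt_cert_prime (n : nat) : pratt_cert n -> is_prime n.
Proof.
elim=> [|{}n g r q e n_gt2 _ _ nE _ q_pr g1 gq]; first exact/is_primeP.
have n_gt1 := ltnW n_gt2; apply: is_prime_of_Zn_inverses => //.
by apply: (pratt_step_inverse n_gt1 nE) g1 gq => i; apply/is_primeP.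
Qed.

Theorem proposition5p3p1 :
  (is_prime 2 *
   (forall n : nat, (2 < n)%N -> pratt_cert n ->
      (forall x : 'Z_n, x <> 0%R -> {y : 'Z_n | (x * y = 1)%R}) * is_prime n))%type.
Proof.
split=> [|n n_gt2 cert]; first exact/is_primeP.
split; last exact: pratt_cert_prime cert.
case: cert n_gt2 => [//|{}n g r q e n_gt2 _ _ nE q_cert g1 gq _].
apply: (pratt_step_inverse (ltnW n_gt2) nE) g1 gq => i.
exact/is_primeP/pratt_cert_prime.
Qed.
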